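(* Let $X$ be a complex Hilbert space and $A$ a closed densely defined symmetric operator in $X$ with domain $D_m$; put $D_{\max}:=\operatorname{dom}(A^* )$ and equip $D_m$, $D_{\max}$ with the graph inner products. Let $D_W$ be a Hilbert space such that: (a) there are continuous inclusions $D_m\hookrightarrow D_W\hookrightarrow D_{\max}\hookrightarrow X$; (b) on $D_m$ the graph norm and the norm of $D_W$ are equivalent; (c) $D_W$ is dense in $D_{\max}$ in the graph norm; (d) there is a self-adjoint Fredholm extension $A_D=A^*|_D$ of $A$ with domain $D$, $D_m\subset D\subset D_W$. Let $A_W:=A^*|_{D_W}$. Then $D/D_m$ and the reduced Cauchy data space $(\ker A_W+D_m)/D_m$ form a Fredholm pair of Lagrangian subspaces of index $0$ in the (weak) symplectic Hilbert space $D_W/D_m$. Moreover, $\operatorname{im}A_W=\operatorname{im}A^*$.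
   Context: The symplectic form on $D_W/D_m$ is induced by Green's form: $\{x+D_m,y+D_m\}:=\langle A^*x,y\rangle_X-\langle x,A^*y\rangle_X$. The Hilbert space structure on $D_W/D_m$ is the quotient structure from $D_W$. A (weak) symplectic form $\omega$ on a complex Hilbert space $H$ is a bounded sesquilinear form with $\omega(y,x)=-\overline{\omega(x,y)}$ and trivial annihilator $\{x:\omega(x,y)=0\ \forall y\}=\{0\}$. A subspace $\lambda$ is Lagrangian if $\lambda=\{y\in H:\omega(x,y)=0\ \forall x\in\lambda\}$. A Fredholm pair $(\lambda,\mu)$ consists of closed subspaces with $\dim(\lambda\cap\mu)<\infty$ and $\lambda+\mu$ closed of finite codimension; its index is $\dim(\lambda\cap\mu)-\dim(H/(\lambda+\mu))$. *)

(* Defs.v *)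
From HB Require Import structures.
From mathcomp Require Import all_boot all_order all_algebra.
From mathcomp Require Import complex.
From mathcomp Require Import ring lra.
From mathcomp Require Import all_classical all_reals topology normedtype.
Set Implicit Arguments.
Unset Strict Implicit.
Unset Printing Implicit Defensive.
Import Order.TTheory GRing.Theory Num.Theory.
Import numFieldNormedType.Exports.
Local Open Scope classical_set_scope.
Local Open Scope quotient_scope.
Local Open Scope ring_scope.

Identity Coercion fun_of_set : set >-> Funclass.

Record lsub (K : fieldType) (V : lmodType K) := Lsub {
  lsub_set :> set V ;
  lsub0 : lsub_set 0 ;
  lsubP : forall a u v, lsub_set u -> lsub_set v -> lsub_set (a *: u + v) }.

Section SubspaceOperations.
Context {K : fieldType} {V : lmodType K}.
Implicit Types U S : lsub V.

Lemma lsubD U u v : U u -> U v -> U (u + v).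
Proof. by move=> Uu Uv; rewrite -[u]scale1r; exact: lsubP. Qed.

Lemma lsubZ U a u : U u -> U (a *: u).
Proof. by move=> Uu; rewrite -[_ *: _]addr0; apply: lsubP => //; exact: lsub0. Qed.

Lemma lsubN U u : U u -> U (- u).
Proof. by rewrite -scaleN1r; exact: lsubZ. Qed.

Lemma lsubB U u v : U u -> U v -> U (u - v).
Proof. by move=> Uu Uv; apply: lsubD => //; exact: lsubN. Qed.

Definition lsubT : lsub V.
Proof. by exists [set: V]. Defined.

Definition addS U S : lsub V.
Proof.
exists [set u + s | u in U & s in S]; first exact: (ex_intro2 _ _ _ (lsub0 U)
  (ex_intro2 _ _ _ (lsub0 S) (addr0 0))).
move=> a _ _ [u Uu [s Ss <-]] [u' Uu' [s' Ss' <-]].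
exists (a *: u + u'); first exact: lsubP.
by exists (a *: s + s'); [exact: lsubP | rewrite scalerDr addrACA].
Defined.

Definition capS U S : lsub V.
Proof.
exists (U `&` S); first by split; exact: lsub0.
by move=> a u v [? ?] [? ?]; split; exact: lsubP.
Defined.

Definition has_dim (U : set V) (n : nat) : Prop := exists b : 'I_n -> V,
  (forall c : 'I_n -> K, \sum_i c i *: b i = 0 -> forall i, c i = 0) /\
  U = range (fun c : 'I_n -> K => \sum_i c i *: b i).

Definition finite_dim (U : set V) : Prop := exists n, has_dim U n.

(* equal to 0 when U is not finite-dimensional *)
Definition dim (U : set V) : nat := xget 0%N [set n | has_dim U n].

End SubspaceOperations.

Section SubspaceImages.
Context {K : fieldType} {V W : lmodType K} (f : {linear V -> W}).

Definition imageS (U : lsub V) : lsub W.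
Proof.
exists (f @` U); first by exists 0; [exact: lsub0 | exact: linear0].
move=> a _ _ [u Uu <-] [v Uv <-].
by exists (a *: u + v); [exact: lsubP | exact: linearP].
Defined.

Definition preimS (U : lsub W) : lsub V.
Proof.
exists (f @^-1` U) => /=; first by rewrite linear0; exact: lsub0.
by move=> a u v Uu Uv; rewrite /= linearP; exact: lsubP.
Defined.

End SubspaceImages.

Section Quotient.
Context {K : fieldType} {V : lmodType K}.

Definition lsub_pred (U : lsub V) : {pred V} := fun x => `[< U x >].

Lemma lsub_predE (U : lsub V) x : (x \in lsub_pred U) = `[< U x >].
Proof. by []. Qed.

Lemma lsub_pred_zmod_closed (U : lsub V) : zmod_closed (lsub_pred U).
Proof.
split; first exact/asboolP/lsub0.
by move=> x y /asboolP Ux /asboolP Uy; exact/asboolP/lsubB.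
Qed.

HB.instance Definition _ (U : lsub V) :=
  GRing.isZmodClosed.Build V (lsub_pred U) (lsub_pred_zmod_closed U).

Definition lquot (U : lsub V) : Type := {ideal_quot (lsub_pred U)}.
HB.instance Definition _ (U : lsub V) := GRing.Zmodule.on (lquot U).

Variable U : lsub V.

Definition lrepr (q : lquot U) : V := repr (q : {ideal_quot (lsub_pred U)}).
Definition lproj (x : V) : lquot U := \pi_{ideal_quot (lsub_pred U)} x.

Lemma lreprK q : lproj (lrepr q) = q.
Proof. exact: reprK. Qed.

Lemma lproj_eq x y : lproj x = lproj y <-> U (x - y).
Proof.
by split=> [/eqP|Uxy]; [|apply/eqP]; rewrite -Quotient.idealrBE lsub_predE;
  [move/asboolP | apply/asboolP].
Qed.

Lemma lproj_is_zmod : zmod_morphism lproj.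
Proof. by move=> x y; exact: (raddfB \pi_{ideal_quot (lsub_pred U)}). Qed.

Lemma lreprP x : U (lrepr (lproj x) - x).
Proof. by apply/lproj_eq; rewrite lreprK. Qed.

Let lscale (a : K) (q : lquot U) : lquot U := lproj (a *: lrepr q).

Let lscaleE a x : lscale a (lproj x) = lproj (a *: x).
Proof. by apply/lproj_eq; rewrite -scalerBr; apply: lsubZ; exact: lreprP. Qed.

Let projD x y : lproj (x + y) = lproj x + lproj y.
Proof. exact: (raddfD \pi_{ideal_quot (lsub_pred U)}). Qed.

Let lscaleA a b q : lscale a (lscale b q) = lscale (a * b) q.
Proof. by rewrite -(lreprK q) !lscaleE scalerA. Qed.

Let lscale1 : left_id 1 lscale.
Proof. by move=> q; rewrite -(lreprK q) lscaleE scale1r. Qed.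

Let lscaleDr : right_distributive lscale +%R.
Proof.
by move=> a p q; rewrite -(lreprK p) -(lreprK q) -projD !lscaleE scalerDr projD.
Qed.

Let lscaleDl q : {morph lscale^~ q : a b / a + b}.
Proof. by move=> a b; rewrite -(lreprK q) !lscaleE scalerDl projD. Qed.

HB.instance Definition _ := GRing.Zmodule_isLmodule.Build K (lquot U)
  lscaleA lscale1 lscaleDr lscaleDl.

Let lproj_scalable : scalable lproj.
Proof. by move=> a x; rewrite -lscaleE. Qed.

HB.instance Definition _ := GRing.isZmodMorphism.Build V (lquot U) lproj lproj_is_zmod.
HB.instance Definition _ := GRing.isScalable.Build K V (lquot U) *:%R lproj lproj_scalable.

End Quotient.
Arguments lproj {K V} U x.

Definition Cplx (R : realType) : numClosedFieldType :=
  Num.ClosedField.clone (complex R) _.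

(* As in the library, scalar products are linear in the first argument. *)
HB.mixin Record hasInner (R : realType) V & CompleteNormedModule (Cplx R) V := {
  inner : V -> V -> Cplx R ;
  innerP : forall a x y z, inner (a *: x + y) z = a * inner x z + inner y z ;
  innerC : forall x y, inner y x = (inner x y)^* ;
  inner_norm : forall x, inner x x = `|x| ^+ 2 }.

#[short(type="hilbertType")]
HB.structure Definition Hilbert (R : realType) :=
  {V of CompleteNormedModule (Cplx R) V & hasInner R V}.

Record closed_lsub (R : realType) (V : hilbertType R) := ClosedLsub {
  closed_lsub_val :> lsub V ;
  closed_lsubP : closed closed_lsub_val }.
Arguments closed_lsubP {R V} c.

Section InnerTheory.
Context {R : realType} {V : hilbertType R}.
Implicit Types (x y z : V) (a : Cplx R).

Lemma innerDl x y z : inner (x + y) z = inner x z + inner y z.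
Proof. by rewrite -[x]scale1r innerP mul1r scale1r. Qed.

Lemma inner0l z : inner 0 z = 0.
Proof. by apply: (addrI (inner 0 z)); rewrite -innerDl !addr0. Qed.

Lemma innerZl a x z : inner (a *: x) z = a * inner x z.
Proof. by rewrite -[a *: x]addr0 innerP inner0l addr0. Qed.

Lemma innerNl x z : inner (- x) z = - inner x z.
Proof. by rewrite -scaleN1r innerZl mulN1r. Qed.

Lemma innerBl x y z : inner (x - y) z = inner x z - inner y z.
Proof. by rewrite innerDl innerNl. Qed.

Lemma innerDr x y z : inner z (x + y) = inner z x + inner z y.
Proof. by rewrite innerC innerDl rmorphD /= -!innerC. Qed.

Lemma innerZr a x z : inner z (a *: x) = a^* * inner z x.
Proof. by rewrite innerC innerZl rmorphM /= -innerC. Qed.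

Lemma innerNr x z : inner z (- x) = - inner z x.
Proof. by rewrite innerC innerNl rmorphN /= -innerC. Qed.

Lemma innerBr x y z : inner z (x - y) = inner z x - inner z y.
Proof. by rewrite innerDr innerNr. Qed.

Lemma inner0r z : inner z 0 = 0.
Proof. by rewrite innerC inner0l conjC0. Qed.

Lemma inner_ge0 x : 0 <= inner x x.
Proof. by rewrite inner_norm exprn_ge0. Qed.

Lemma inner_eq0 x : inner x x = 0 -> x = 0.
Proof. by rewrite inner_norm => /eqP; rewrite expf_eq0 /= normr_eq0 => /eqP. Qed.

Lemma normBE x y : `|x - y| ^+ 2 =
  `|x| ^+ 2 + `|y| ^+ 2 - (inner x y + inner y x).
Proof. by rewrite -!inner_norm innerBl !innerBr; ring. Qed.

Lemma normDE x y : `|x + y| ^+ 2 =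
  `|x| ^+ 2 + `|y| ^+ 2 + (inner x y + inner y x).
Proof. by rewrite -!inner_norm innerDl !innerDr; ring. Qed.

Lemma parallelogram x y :
  `|x - y| ^+ 2 + `|x + y| ^+ 2 = 2 * (`|x| ^+ 2 + `|y| ^+ 2).
Proof. by rewrite normBE normDE; ring. Qed.

End InnerTheory.

Section Projection.
Context {R : realType} {V : hilbertType R} (M : closed_lsub V) (x : V).

Let rc : {rmorphism R -> Cplx R} := GRing.RMorphism.clone _ _ (real_complex R) _.
Let le_rc (a b : R) : (rc a <= rc b) = (a <= b). Proof. exact: lecR. Qed.
Let lt_rc (a b : R) : (rc a < rc b) = (a < b). Proof. exact: ltcR. Qed.

Let nsq (y : V) : R := complex.Re (`|y| ^+ 2 : Cplx R).

Let nsqE y : rc (nsq y) = `|y| ^+ 2.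
Proof. by apply: RRe_real; exact: rpredX (normr_real _). Qed.

Let nsq_ge0 y : 0 <= nsq y.
Proof. by rewrite -le_rc nsqE exprn_ge0. Qed.

Let delta : R := inf [set nsq (x - m) | m in M].

Let delta_lb m : M m -> delta <= nsq (x - m).
Proof.
move=> Mm; apply: ge_inf; last by exists m.
by exists 0 => _ [k _ <-]; exact: nsq_ge0.
Qed.

Let delta_approx (e : R) : 0 < e -> exists2 m, M m & nsq (x - m) < delta + e.
Proof.
move=> e0; have [|_ [m Mm <-] me] := @inf_adherent _ [set nsq (x - m) | m in M] e e0.
  split; first by exists (nsq (x - 0)), 0 => //; exact: lsub0.
  by exists 0 => _ [k _ <-]; exact: nsq_ge0.
by exists m.
Qed.

Let E (e : R) : set V := [set m | M m /\ nsq (x - m) < delta + e].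

Let E_diam e m m' : E e m -> E e m' -> nsq (m - m') <= 4 * e.
Proof.
move=> [Mm me] [Mm' m'e].
have : nsq (m' - m) + 4 * nsq (x - 2^-1 *: (m + m'))
     = 2 * (nsq (x - m) + nsq (x - m')).
  apply: (fmorph_inj rc); rewrite rmorphD !rmorphM !rmorph_nat rmorphD !nsqE.
  rewrite -parallelogram; congr (`|_| ^+ 2 + _).
    by rewrite opprB [RHS]addrC addrA subrK.
  have -> : (4 : Cplx R) = `|2 : Cplx R| ^+ 2 by rewrite normr_nat -natrX.
  rewrite -exprMn -normrZ scalerBr scalerA divff ?pnatr_eq0// scale1r.
  by rewrite scaler_nat mulr2n opprD addrACA.
have : delta <= nsq (x - 2^-1 *: (m + m')).
  by apply: delta_lb; apply: lsubZ; exact: lsubD.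
have -> : nsq (m' - m) = nsq (m - m') by rewrite /nsq distrC.
lra.
Qed.

Let F : set_system V := filter_from [set e : R | 0 < e] E.

Let F_proper : ProperFilter F.
Proof.
apply: filter_from_proper; last first.
  by move=> e /delta_approx[m Mm me]; exists m.
apply: filter_from_filter; first by exists 1 => /=.
move=> e e' /= e0 e'0; exists (Num.min e e'); first by rewrite /= lt_min e0.
move=> m [Mm]; rewrite addr_minr lt_min => /andP[? ?].
by split; split.
Qed.

Let F_cauchy : cauchy F.
Proof.
have FF : Filter F by apply: @filter_filter; exact: F_proper.
apply: cauchy_exP => eps eps0.
have eR : eps \is Num.real by exact: gtr0_real.
have epsE : rc (complex.Re eps) = eps by exact: RRe_real.
have r0 : 0 < complex.Re eps by rewrite -lt_rc epsE.
set r := complex.Re eps in epsE r0.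
have e0 : 0 < r ^+ 2 / 8 by rewrite divr_gt0// exprn_gt0.
have [m Mm me] := delta_approx e0.
exists m, (r ^+ 2 / 8) => // m' Em'.
rewrite -ball_normE /ball_ /= -(@ltr_pXn2r _ 2)// ?nnegrE ?(ltW eps0)//.
rewrite -nsqE -epsE -rmorphXn lt_rc.
apply: le_lt_trans (E_diam (conj Mm me) Em') _.
have : 0 < r ^+ 2 by rewrite exprn_gt0.
lra.
Qed.

Lemma projection_exists : exists2 y, M y & forall m, M m -> inner (x - y) m = 0.
Proof.
have FP := F_proper.
have /cvg_ex[y Fy] : cvg F by exact: (cauchy_cvg F F_cauchy).
have My : M y.
  refine (@closed_cvg _ _ F FP id (M : set V) (closed_lsubP M) _ y Fy).
  by exists 1 => //= m [].
have le_delta : nsq (x - y) <= delta.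
  rewrite leNgt; apply/negP => lt_d.
  pose a := Num.sqrt (nsq (x - y)).
  have a0 : 0 <= a by exact: sqrtr_ge0.
  have aa : a ^+ 2 = nsq (x - y) by rewrite sqr_sqrtr.
  pose e := (nsq (x - y) - delta) / 4.
  have e0 : 0 < e by rewrite divr_gt0// subr_gt0.
  pose e' := Num.min 1 (e / (2 * a + 1)).
  have p0 : 0 < 2 * a + 1 by lra.
  have e'0 : 0 < e' by rewrite lt_min ltr01 divr_gt0.
  have [m []] : exists m, E e m /\ `|y - m| < rc e'.
    have e'C : 0 < rc e' by rewrite lt_rc.
    have Fe : F [set m | `|y - m| < rc e'].
      by apply: Fy; apply/nbhs_normP; exists (rc e').
    have FE : F (E e) by exists e.
    have [m [? ?]] := filter_ex (filterI FE Fe).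
    by exists m.
  move=> [Mm me] ym.
  pose b := Num.sqrt (nsq (x - m)).
  have nE z : `|z| = rc (Num.sqrt (nsq z)).
    apply/eqP; rewrite -(@eqrXn2 _ 2)// ?le_rc ?sqrtr_ge0//.
    by rewrite -rmorphXn /= sqr_sqrtr// nsqE.
  have bb : b ^+ 2 = nsq (x - m) by rewrite sqr_sqrtr.
  have b0 : 0 <= b by exact: sqrtr_ge0.
  have ab : a <= b + e'.
    rewrite -le_rc rmorphD /= -!nE.
    have -> : x - y = (x - m) - (y - m) by rewrite opprB addrA subrK.
    by apply: (le_trans (ler_normB _ _)); rewrite lerD2l ltW.
  have ba : b < a.
    rewrite -(@ltr_pXn2r _ 2)// ?nnegrE// aa bb.
    by apply: lt_le_trans me _; rewrite /e; lra.
  have e'1 : e' <= 1 by rewrite ge_min lexx.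
  have e'e : (2 * a + 1) * e' <= e.
    by rewrite mulrC -ler_pdivlMr// ge_min lexx orbT.
  have : a ^+ 2 <= b ^+ 2 + e.
    by apply: (@le_trans _ _ ((b + e') ^+ 2)); nra.
  by rewrite aa bb /e in e'e me e0 *; lra.
exists y => // m Mm; set w := x - y; set c := inner w m.
have c0 : 0 <= `|c| ^+ 2 by exact: exprn_ge0.
have m0 : 0 <= `|m| ^+ 2 by exact: exprn_ge0.
pose s := (`|m| ^+ 2 + 1)^-1.
have d0 : 0 < `|m| ^+ 2 + 1 by exact: ltr_wpDl.
have s0 : 0 < s by rewrite invr_gt0.
have : `|w| ^+ 2 <= `|w - (s * c) *: m| ^+ 2.
  rewrite -!nsqE le_rc; apply: le_trans le_delta _.
  rewrite /w -addrA -opprD; apply: delta_lb.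
  by apply: lsubD => //; exact: lsubZ.
rewrite [leRHS]normBE -addrA lerDl.
have -> : `|(s * c) *: m| ^+ 2 = s ^+ 2 * `|c| ^+ 2 * `|m| ^+ 2.
  by rewrite normrZ normrM (gtr0_norm s0) !exprMn.
rewrite innerZl innerZr -/c (_ : inner m w = c^*); last by rewrite -innerC.
rewrite rmorphM /= (CrealP (gtr0_real s0)) -!mulrA [c^* * c]mulrC -normCK.
set t := `|c| ^+ 2 in c0 *; rewrite -mulrDr.
have sm : s * `|m| ^+ 2 = 1 - s.
  apply: (canRL (addrK _)).
  by rewrite -[X in _ + X]mulr1 -mulrDr mulVf// gt_eqF.
rewrite (_ : _ - _ = - (s * (1 + s) * t)); last first.
  transitivity (s * t * (s * `|m| ^+ 2) - 2 * (s * t)); first by rewrite /t; ring.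
  by rewrite sm; ring.
rewrite oppr_ge0 pmulr_rle0; last by rewrite mulr_gt0// addr_gt0.
move=> t0; have /eqP : t = 0 by apply/eqP; rewrite eq_le t0.
by rewrite expf_eq0 /= normr_eq0 => /eqP.
Qed.
End Projection.

Section InnerDot.
Context {R : realType} {V : hilbertType R}.

Let inner_zmodl (u : V) : zmod_morphism (fun x : V => inner x u).
Proof. by move=> x y; exact: innerBl. Qed.

Let inner_zmodr (u : V) : zmod_morphism (inner u).
Proof. by move=> x y; exact: innerBr. Qed.

Let inner_scalel (u : V) : scalable_for *%R (fun x : V => inner x u).
Proof. by move=> a x; exact: innerZl. Qed.

Let inner_scaler (u : V) : scalable_for (Num.conj \; *%R) (inner u).
Proof. by move=> a x; exact: innerZr. Qed.

Let inner_herm (x y : V) : inner x y = (-1) ^+ false * (inner y x)^*.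
Proof. by rewrite mul1r -innerC. Qed.

Let inner_gt0 (x : V) : x != 0 -> 0 < inner x x.
Proof. by move=> x0; rewrite inner_norm exprn_gt0// normr_gt0. Qed.

HB.instance Definition _ := isBilinear.Build (Cplx R) V V (Cplx R)
  *%R (Num.conj \; *%R) inner inner_zmodl inner_zmodr inner_scalel inner_scaler.
HB.instance Definition _ := isHermitianSesquilinear.Build (Cplx R) V
  false Num.conj inner inner_herm.
HB.instance Definition _ := isDotProduct.Build (Cplx R) V inner inner_gt0.
End InnerDot.

Definition hquot (R : realType) (V : hilbertType R) (M : closed_lsub V) : Type :=
  lquot M.

Section HilbertQuotient.
Context {R : realType} {V : hilbertType R} (M : closed_lsub V).

HB.instance Definition _ := GRing.Lmodule.on (hquot M).

Definition hproj : {linear V -> hquot M} := lproj M.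

Lemma hproj_eq x y : hproj x = hproj y <-> M (x - y).
Proof. exact: lproj_eq. Qed.

Let hrepr_subproof (q : hquot M) :
  exists x, hproj x = q /\ forall m, M m -> inner x m = 0.
Proof.
have [y My orth] := projection_exists M (lrepr q).
exists (lrepr q - y); split=> //.
rewrite -[RHS]lreprK; apply/hproj_eq.
by rewrite addrAC subrr add0r; exact: lsubN.
Qed.

(* the representative orthogonal to M, i.e. the one of minimal norm; the norm and
   the scalar product of [hquot M] are those of these representatives *)
Definition hrepr (q : hquot M) : V := projT1 (cid (hrepr_subproof q)).

Lemma hreprK q : hproj (hrepr q) = q.
Proof. by rewrite /hrepr; case: cid => x []. Qed.

Lemma hrepr_orth q m : M m -> inner (hrepr q) m = 0.
Proof. by rewrite /hrepr; case: cid => x [_] /= /[apply]. Qed.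

Lemma hrepr_uniq q x : hproj x = q -> (forall m, M m -> inner x m = 0) ->
  hrepr q = x.
Proof.
move=> xq xM; have Md : M (hrepr q - x) by apply/hproj_eq; rewrite hreprK.
by apply/subr0_eq/inner_eq0; rewrite {1}innerBl hrepr_orth// xM// subrr.
Qed.

Lemma hreprP a p q : hrepr (a *: p + q) = a *: hrepr p + hrepr q.
Proof.
apply: hrepr_uniq; first by rewrite linearP !hreprK.
by move=> m Mm; rewrite innerP !hrepr_orth// mulr0 addr0.
Qed.

Lemma hreprD p q : hrepr (p + q) = hrepr p + hrepr q.
Proof. by rewrite -[p]scale1r hreprP !scale1r. Qed.

Lemma hrepr0 : hrepr 0 = 0.
Proof. by apply: hrepr_uniq => [|m _]; [exact: linear0 | exact: inner0l]. Qed.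

Lemma hreprZ a q : hrepr (a *: q) = a *: hrepr q.
Proof. by rewrite -[a *: q]addr0 hreprP hrepr0 addr0. Qed.

Let hnorm (q : hquot M) : Cplx R := `|hrepr q|.

Let hnormD p q : hnorm (p + q) <= hnorm p + hnorm q.
Proof. by rewrite /hnorm hreprD ler_normD. Qed.

Let hnormZ a q : hnorm (a *: q) = `|a| * hnorm q.
Proof. by rewrite /hnorm hreprZ normrZ. Qed.

Let hnorm0_eq0 q : hnorm q = 0 -> q = 0.
Proof. by move=> /normr0_eq0 q0; rewrite -(hreprK q) q0 linear0. Qed.

HB.instance Definition _ := @Lmodule_isNormed.Build (Cplx R) (hquot M)
  hnorm hnormD hnormZ hnorm0_eq0.

Lemma hquot_normE (q : hquot M) : `|q| = `|hrepr q|.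
Proof. by []. Qed.

(* with [hreprK] and [hquot_normE]: the norm of a coset is the minimum of the
   norms of its elements *)
Lemma hproj_norm_le x : `|hproj x| <= `|x|.
Proof.
set y := hrepr (hproj x).
have My : M (x - y) by apply/hproj_eq; rewrite hreprK.
rewrite hquot_normE -/y -(@ler_pXn2r _ 2)// ?nnegrE//.
rewrite -[in leRHS](subrK y x) normDE innerC hrepr_orth// conjC0 !addr0.
by rewrite lerDr exprn_ge0.
Qed.

Let hquot_complete (F : set_system (hquot M)) :
  ProperFilter F -> cauchy F -> cvg F.
Proof.
move=> FF /cauchyP Fc.
have reprB p q : hrepr (p - q) = hrepr p - hrepr q.
  by rewrite -scaleN1r addrC hreprP scaleN1r addrC.
have : cauchy (hrepr @ F).
  apply: cauchy_exP => e e0; have [q Fq] := Fc e e0.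
  exists (hrepr q); rewrite /fmap /=; apply: filterS Fq => p.
  by rewrite -!ball_normE /ball_ /= -reprB.
move=> /(cauchy_cvg _) /cvg_ex[l hl].
apply/cvg_ex; exists (hproj l).
rewrite -[F](_ : hproj \o hrepr @ F = F); last first.
  by rewrite (_ : _ \o _ = id) ?fmap_id//; apply/funext => q /=; rewrite hreprK.
apply/cvgrPdist_lt => e e0.
have /cvgrPdist_lt/(_ e e0) := hl; apply: filterS => q /=.
by apply: le_lt_trans; rewrite -linearB; exact: hproj_norm_le.
Qed.

HB.instance Definition _ := Uniform_isComplete.Build (hquot M) hquot_complete.

Let hinner (p q : hquot M) : Cplx R := inner (hrepr p) (hrepr q).

Let hinnerP a p q r : hinner (a *: p + q) r = a * hinner p r + hinner q r.
Proof. by rewrite /hinner hreprP innerP. Qed.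

Let hinnerC p q : hinner q p = (hinner p q)^*.
Proof. by rewrite /hinner innerC. Qed.

Let hinner_norm q : hinner q q = `|q| ^+ 2.
Proof. exact: inner_norm. Qed.

HB.instance Definition _ := @hasInner.Build R (hquot M) hinner
  hinnerP hinnerC hinner_norm.

End HilbertQuotient.
Arguments hproj {R V} M.

Section Operators.
Context {R : realType} {X : hilbertType R}.

(* Operators are identified with their graphs.  A linear relation is a possibly
   multivalued operator; the adjoint of a relation is single-valued exactly when
   the relation has dense domain. *)
Definition linrel : Type := lsub (X * X)%type.
Identity Coercion lsub_of_linrel : linrel >-> lsub.
Implicit Types T S : linrel.

Definition single_valued T : Prop :=
  forall x y z, T (x, y) -> T (x, z) -> y = z.

Definition op_dom T : lsub X.
Proof.
exists [set x | exists y, T (x, y)]; first by exists 0; exact: lsub0.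
by move=> a u v [y Ty] [z Tz]; exists (a *: y + z); exact: (lsubP a Ty Tz).
Defined.

Definition op_ran T : lsub X.
Proof.
exists [set y | exists x, T (x, y)]; first by exists 0; exact: lsub0.
by move=> a u v [y Ty] [z Tz]; exists (a *: y + z); exact: (lsubP a Ty Tz).
Defined.

Definition op_ker T : lsub X.
Proof.
exists [set x | T (x, 0)]; first exact: lsub0.
move=> a u v Tu Tv /=.
have -> : (a *: u + v, 0) = a *: (u, 0) + (v, 0) :> X * X.
  by congr pair; rewrite /= ?scaler0 ?addr0.
exact: lsubP.
Defined.

(* the value T x of an operator T at a point x of its domain *)
Definition opval T (x : X) : X := xget 0 [set y | T (x, y)].

Definition op_restrict T (D : lsub X) : linrel.
Proof.
exists [set p | T p /\ D p.1]; first by split; exact: lsub0.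
by move=> a p q [Tp Dp] [Tq Dq]; split; exact: lsubP.
Defined.

Definition adjoint T : linrel.
Proof.
exists [set p | forall q, T q -> inner q.2 p.1 = inner q.1 p.2].
  by move=> q _; rewrite !inner0r.
move=> a p p' Tp Tp' q Tq /=.
by rewrite !innerDr !innerZr Tp// Tp'.
Defined.

Definition op_symmetric T : Prop := T `<=` adjoint T.

Definition self_adjoint T : Prop := T = adjoint T :> set (X * X).

Definition fredholm T : Prop :=
  [/\ closed (T : set (X * X)), finite_dim (op_ker T), closed (op_ran T)
    & finite_dim [set: lquot (op_ran T)]].

Definition graph_inner T (x y : X) : Cplx R :=
  inner x y + inner (opval T x) (opval T y).

Definition graph_norm T (x : X) : Cplx R := sqrtC (graph_inner T x x).

Lemma norm_le_graph_norm T x : `|x| <= graph_norm T x.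
Proof.
rewrite -(@ler_pXn2r _ 2)// ?nnegrE// ?sqrtC_ge0 /graph_inner ?addr_ge0 ?inner_ge0//.
by rewrite sqrtCK -inner_norm lerDl inner_ge0.
Qed.

Lemma opval_le_graph_norm T x : `|opval T x| <= graph_norm T x.
Proof.
rewrite -(@ler_pXn2r _ 2)// ?nnegrE// ?sqrtC_ge0 /graph_inner ?addr_ge0 ?inner_ge0//.
by rewrite sqrtCK -inner_norm lerDr inner_ge0.
Qed.

End Operators.
Arguments linrel {R} X.

(* closed symmetric densely defined operators *)
Record csd_operator (R : realType) (X : hilbertType R) := CsdOperator {
  csd_graph :> linrel X ;
  csd_single_valued : single_valued csd_graph ;
  csd_closed : closed (csd_graph : set (X * X)) ;
  csd_dense : dense (op_dom csd_graph) ;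
  csd_symmetric : op_symmetric csd_graph }.

(* [j] is the inclusion of [W] in [X].  Continuity of these linear maps is
   expressed by bounds; that of the inclusion of [op_dom (adjoint A)] in [X] is
   [norm_le_graph_norm]. *)
Record intermediate_space (R : realType) (X W : hilbertType R)
    (A : csd_operator X) (j : {linear W -> X}) : Prop := {
  incl_inj : injective j ;
  dom_min_sub : op_dom A `<=` range j ;
  sub_dom_max : range j `<=` op_dom (adjoint A) ;
  incl_min_continuous : exists k, forall w, op_dom A (j w) ->
    `|w| <= k * graph_norm A (j w) ;
  incl_max_continuous : exists k, forall w,
    graph_norm (adjoint A) (j w) <= k * `|w| }.

Section AdjointTheory.
Context {R : realType} {X : hilbertType R}.
Implicit Types T : linrel X.

Lemma dense_orth_eq0 (S : set X) z :
  dense S -> (forall x, S x -> inner x z = 0) -> z = 0.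
Proof.
move=> dS zS; apply/eqP; apply: contraT => z0.
have nz0 : 0 < `|z| by rewrite normr_gt0.
have [x [zx Sx]] : ball z `|z| `&` S !=set0.
  by apply: dS; [exists z; exact: ballxx | exact: ball_open].
move: zx; rewrite -ball_normE /ball_ /= -(@ltr_pXn2r _ 2)// ?nnegrE//.
rewrite normBE [inner z x]innerC (zS _ Sx) conjC0 !addr0 subr0 gtrDl.
by move=> x_lt0; have := le_lt_trans (exprn_ge0 2 (normr_ge0 x)) x_lt0; rewrite ltxx.
Qed.

Lemma adjoint_single_valued T : dense (op_dom T) -> single_valued (adjoint T).
Proof.
move=> dT x y z xy xz; apply/subr0_eq/(dense_orth_eq0 dT) => u [v uv].
by rewrite innerBr -(xy _ uv) -(xz _ uv) subrr.
Qed.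

Lemma opvalP T x : op_dom T x -> T (x, opval T x).
Proof. by move=> [y Ty]; exact: (@xgetI _ 0 [set y | T (x, y)] y Ty). Qed.

Lemma opval_eq T x y : single_valued T -> T (x, y) -> opval T x = y.
Proof. by move=> sT Txy; apply: (sT x) => //; apply: opvalP; exists y. Qed.

End AdjointTheory.

Section ReducedSpace.
Context {R : realType} {X W : hilbertType R} {A : csd_operator X}.
Context {j : {linear W -> X}} (hW : intermediate_space A j).

Let g (w : W) : X := opval (adjoint A) (j w).

Let gP w : adjoint A (j w, g w).
Proof. by apply: opvalP; apply: (sub_dom_max hW); exists w. Qed.

Let g_linear : linear g.
Proof.
move=> a u v; apply: opval_eq; first exact/adjoint_single_valued/csd_dense.
rewrite linearP; exact: (lsubP a (gP u) (gP v)).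
Qed.

Let bound_continuous (f : {linear W -> X}) :
  (exists k, forall w, `|f w| <= k * `|w|) -> continuous f.
Proof.
move=> [k fk]; apply: bounded_linear_continuous; apply/linear_boundedP.
exists `|k|; split=> [|r kr w]; first exact: normr_real.
have [-> |w0] := eqVneq w 0; first by rewrite linear0 !normr0 mulr0.
apply: le_trans (fk w) _.
have kr0 : k \is Num.real.
  have := le_trans (normr_ge0 _) (fk w).
  by rewrite pmulr_lge0 ?normr_gt0// => /ger0_real.
by rewrite ler_wpM2r//; apply: le_trans (real_ler_norm kr0) (ltW kr).
Qed.

Lemma dom_min_closed : closed (preimS j (op_dom A)).
Proof.
have [k jk] := incl_max_continuous hW.
have jc : continuous j.
  apply: bound_continuous; exists k => w.
  by apply: le_trans (jk w); exact: norm_le_graph_norm.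
pose gl : {linear W -> X} :=
  HB.pack g (GRing.isLinear.Build (Cplx R) W X *:%R g g_linear).
have gc : continuous g.
  apply: (@bound_continuous gl); exists k => w.
  by apply: le_trans (jk w); exact: opval_le_graph_norm.
rewrite [X in closed X](_ : _ = (fun w => (j w, g w)) @^-1` A).
  apply: preimage_closed; last exact: csd_closed.
  by move=> w _; apply: cvg_pair; [exact: jc | exact: gc].
apply/seteqP; split=> w /= => [[y Ay]|Aw]; last by exists (g w).
suff -> : g w = y by [].
apply: opval_eq; first exact/adjoint_single_valued/csd_dense.
exact: (csd_symmetric Ay).
Qed.

(* [op_dom A] as a closed subspace of [W] *)
Definition dom_min : closed_lsub W := ClosedLsub dom_min_closed.

(* the image in [W / op_dom A] of a subspace [U] of [W], seen in [X]; it is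
   [U / op_dom A] when [op_dom A `<=` U] *)
Definition reduced (U : lsub X) : lsub (hquot dom_min) :=
  imageS (hproj dom_min) (preimS j U).

End ReducedSpace.
Arguments dom_min {R X W A j} hW.
Arguments reduced {R X W A j} hW U.

Definition green_form (R : realType) (X : hilbertType R) (T : linrel X)
    (x y : X) : Cplx R :=
  inner (opval (adjoint T) x) y - inner x (opval (adjoint T) y).

(* [green_form] on representatives of the classes [p] and [q] *)
Definition reduced_form (R : realType) (X W : hilbertType R)
    (A : csd_operator X) (j : {linear W -> X}) (hW : intermediate_space A j)
    (p q : hquot (dom_min hW)) : Cplx R :=
  green_form A (j (lrepr p)) (j (lrepr q)).
Arguments reduced_form {R X W A j} hW p q.

Section Symplectic.
Context {R : realType} {H : hilbertType R}.
Implicit Types (omega : H -> H -> Cplx R) (l m : lsub H).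

Record weak_symplectic omega : Prop := {
  symplecticPl : forall a x y z,
    omega (a *: x + y) z = a * omega x z + omega y z ;
  symplecticPr : forall a x y z,
    omega z (a *: x + y) = a^* * omega z x + omega z y ;
  symplectic_bounded : exists k, forall x y, `|omega x y| <= k * `|x| * `|y| ;
  symplectic_skew : forall x y, omega y x = - (omega x y)^* ;
  symplectic_nondegenerate :
    [set x | forall y, omega x y = 0] = [set 0] }.

Definition lagrangian omega l : Prop :=
  l = [set y | forall x, l x -> omega x y = 0] :> set H.

Definition fredholm_pair l m : Prop :=
  [/\ closed l, closed m, finite_dim (capS l m), closed (addS l m)
    & finite_dim [set: lquot (addS l m)]].

Definition fredholm_index l m : int :=
  (dim (capS l m))%:Z - (dim [set: lquot (addS l m)])%:Z.

End Symplectic.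

(* Main.v *)
(* With U the intersection of λ = D/D_m and μ = (ker A_W + D_m)/D_m, everything
   follows from the algebra of the symplectic form ω once ω is known to be
   nondegenerate and U^ω to be contained in λ + μ.  The latter holds because
   ω(w, n) = <A^* w, n> for n in ker A_D, so that A^* w is orthogonal to ker A_D,
   hence lies in ran A_D.  Both λ and μ being isotropic, λ + μ = U^ω; it is closed
   and of codimension dim U, by nondegeneracy, whence the index 0, and U^ωω = U
   gives μ^ω = μ.  Nondegeneracy is the density of W combined with A^** = A.
   For y = A^* x, a family in W dual to a basis of U yields w such that
   A^* w - y is orthogonal to ker A_D, so y lies in ran A_W + ran A_D = ran A_W. *)
Require Import Defs.
From HB Require Import structures.
From mathcomp Require Import all_boot all_order all_algebra.
From mathcomp Require Import all_classical all_reals topology normedtype.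
Set Implicit Arguments.
Unset Strict Implicit.
Unset Printing Implicit Defensive.
Import Order.TTheory GRing.Theory Num.Theory.
Import numFieldNormedType.Exports.
Local Open Scope classical_set_scope.
Local Open Scope ring_scope.

(** * Finite dimension, and families dual to linear functionals *)

Lemma sum_mulr_eq (K : nzRingType) n (c : 'I_n -> K) i :
  \sum_k c k * (i == k)%:R = c i.
Proof.
rewrite (bigD1 i)//= eqxx mulr1 big1 ?addr0// => k ki.
by rewrite eq_sym (negPf ki) mulr0.
Qed.

Section Dimension.
Context {K : fieldType} {V : lmodType K}.

Lemma mem_span n (b : 'I_n -> V) i :
  range (fun c : 'I_n -> K => \sum_i c i *: b i) (b i).
Proof.
exists (fun k => (k == i)%:R) => //.
rewrite (bigD1 i)//= eqxx scale1r big1 ?addr0// => k /negPf ->.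
by rewrite scale0r.
Qed.

(** Each basis expands in the other; by freeness of [b] the coefficient matrices multiply to the
    identity of size [n], which thus factors through size [m]. *)
Lemma has_dim_le (U : set V) n m : has_dim U n -> has_dim U m -> (n <= m)%N.
Proof.
move=> [b [bfree ->]] [d [_ bd]].
have /choice[M bM] : forall i, exists c : 'I_m -> K, b i = \sum_k c k *: d k.
  by move=> i; have := mem_span b i; rewrite bd => -[c _ <-]; exists c.
have /choice[N dN] : forall k, exists c : 'I_n -> K, d k = \sum_i c i *: b i.
  by move=> k; have := mem_span d k; rewrite -bd => -[c _ <-]; exists c.
suff : (\matrix_(i, k) M i k) *m (\matrix_(k, i) N k i) = 1%:M by exact: mulmx1_min.
apply/matrixP => i i'; apply/eqP; rewrite -subr_eq0 !mxE; apply/eqP.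
under eq_bigr do rewrite !mxE.
apply: (bfree (fun i' => \sum_k M i k * N k i' - (i == i')%:R)).
under eq_bigr do rewrite scalerBl.
apply/eqP; rewrite sumrB subr_eq0; apply/eqP; transitivity (b i); last first.
  rewrite (bigD1 i)//= eqxx scale1r big1 ?addr0// => k.
  by rewrite eq_sym => /negPf ->; rewrite scale0r.
rewrite [RHS]bM.
under eq_bigr do rewrite scaler_suml.
rewrite exchange_big /=; apply: eq_bigr => k _.
by rewrite dN scaler_sumr; apply: eq_bigr => i0 _; rewrite scalerA.
Qed.

Lemma dim_eq (U : set V) n : has_dim U n -> Defs.dim U = n.
Proof.
move=> Un; have Ud := @xgetI _ 0%N [set n | has_dim U n] n Un.
by apply/eqP; rewrite eqn_leq; apply/andP; split; [exact: has_dim_le Ud Un | exact: has_dim_le Un Ud].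
Qed.

(** Induction on [n]: if [b] is not free, a relation with [c i] nonzero expresses [b i] through the
    other vectors, and dropping it keeps the span. *)
Lemma span_finite_dim n (b : 'I_n -> V) :
  finite_dim (range (fun c : 'I_n -> K => \sum_i c i *: b i)).
Proof.
elim: n b => [|n IHn] b; first by exists 0%N, b; split => // c _ [].
have [free|] := pselect (forall c : 'I_n.+1 -> K,
    \sum_i c i *: b i = 0 -> forall i, c i = 0); first by exists n.+1, b.
move=> /existsNP[c /not_implyP[cb /existsNP[i /eqP ci]]].
have bi : b i = \sum_k (- (c i)^-1 * c (lift i k)) *: b (lift i k).
  move: cb; rewrite (bigD1_ord i)//= => /(congr1 ( *:%R (c i)^-1)).
  rewrite scaler0 scalerDr scalerA mulVf// scale1r => /eqP.
  rewrite addr_eq0 => /eqP ->; rewrite scaler_sumr -sumrN.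
  by apply: eq_bigr => k _; rewrite mulNr scaleNr scalerA.
rewrite [X in finite_dim X](_ : _ = range (fun c' : 'I_n -> K =>
    \sum_k c' k *: b (lift i k))); first exact: IHn.
apply/seteqP; split=> _ [d _ <-].
  exists (fun k => d (lift i k) - d i * (c i)^-1 * c (lift i k)) => //.
  rewrite [RHS](bigD1_ord i)//= bi scaler_sumr -big_split/=.
  by apply: eq_bigr => k _; rewrite scalerA -scalerDl mulrA mulrN mulNr addrC.
exists (fun k => if unlift i k is Some k' then d k' else 0) => //.
rewrite (bigD1_ord i)//= unlift_none scale0r add0r.
by apply: eq_bigr => k _; rewrite liftK.
Qed.

(** [V] may be infinite-dimensional; the induction is on the number of functionals. All but the
    first have a dual family, which is then corrected, as in Gram-Schmidt, to accommodate the
    first. *)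
Lemma dual_family n (f : 'I_n -> V -> K)
    (f_lin : forall i a u v, f i (a *: u + v) = a * f i u + f i v) :
    (forall c : 'I_n -> K, (forall v, \sum_i c i * f i v = 0) -> forall i, c i = 0) ->
  exists e : 'I_n -> V, forall i k, f i (e k) = (i == k)%:R.
Proof.
elim: n f f_lin => [|n IHn] f f_lin free; first by exists (fun=> 0) => -[].
have fD i u v : f i (u + v) = f i u + f i v.
  by rewrite -[u]scale1r f_lin mul1r scale1r.
have f0 i : f i 0 = 0 by apply: (addrI (f i 0)); rewrite -fD !addr0.
have fZ i a u : f i (a *: u) = a * f i u by rewrite -[_ *: _]addr0 f_lin f0 addr0.
have fS i m (d : 'I_m -> K) (e : 'I_m -> V) :
    f i (\sum_k d k *: e k) = \sum_k d k * f i (e k).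
  rewrite (big_morph (f i) (fD i) (f0 i)).
  by apply: eq_bigr => k _; exact: fZ.
pose g k := f (lift ord0 k).
have gfree c : (forall v, \sum_i c i * g i v = 0) -> forall k, c k = 0.
  move=> cf k.
  have := free (fun i => if unlift ord0 i is Some i' then c i' else 0).
  move=> /(_ _ (lift ord0 k)); rewrite liftK; apply=> v.
  rewrite big_ord_recl unlift_none mul0r add0r -[RHS](cf v).
  by apply: eq_bigr => i _; rewrite liftK.
have [e eP] := IHn g (fun k => f_lin (lift ord0 k)) gfree.
(* Otherwise [f ord0] would be the combination of the [g k] with coefficients [f ord0 (e k)],
   against freeness. *)
have [x xP] : exists x, f ord0 x - \sum_k f ord0 (e k) * g k x != 0.
  apply: contrapT => /forallNP nx.
  have /free/(_ ord0)/eqP : forall v, \sum_i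
      (if unlift ord0 i is Some k then - f ord0 (e k) else 1) * f i v = 0.
    move=> v; have /negP := nx v; rewrite negbK => /eqP; apply: etrans.
    rewrite big_ord_recl unlift_none mul1r -sumrN; congr (_ + _).
    by apply: eq_bigr => k _; rewrite liftK mulNr.
  by rewrite unlift_none oner_eq0.
(* Removing the components of [x] along [e] makes every [g k] vanish, while [f ord0] takes the
   nonzero value of [xP]. *)
pose y := x - \sum_k g k x *: e k.
have yE i : f i y = f i x - \sum_k g k x * f i (e k).
  by rewrite /y fD -scaleN1r fZ fS mulN1r.
have y0 : f ord0 y != 0.
  by rewrite yE; under eq_bigr do rewrite mulrC.
have yl k : g k y = 0.
  rewrite [LHS]yE -/(g k x) (bigD1 k)//= -/(g k (e k)) eP eqxx mulr1.
  rewrite big1 ?addr0 ?subrr// => i ik.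
  by rewrite -/(g k (e i)) eP eq_sym (negPf ik) mulr0.
pose z := (f ord0 y)^-1 *: y.
have z0 : f ord0 z = 1 by rewrite fZ mulVf.
have zl k : g k z = 0 by rewrite [LHS]fZ -/(g k y) yl mulr0.
exists (fun i => if unlift ord0 i is Some k then e k - f ord0 (e k) *: z else z).
move=> i k /=; case: (unliftP ord0 k) => [k'|] ->; last first.
  case: (unliftP ord0 i) => [i'|] ->; last by rewrite z0 eqxx.
  by rewrite -/(g i' z) zl eq_sym (negPf (neq_lift _ _)).
rewrite fD -scaleN1r fZ fZ mulN1r; case: (unliftP ord0 i) => [i'|] ->.
  rewrite -/(g i' z) zl mulr0 oppr0 addr0 -/(g i' (e k')) eP.
  by rewrite (inj_eq lift_inj).
by rewrite z0 mulr1 subrr.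
Qed.

End Dimension.

(** * Annihilators with respect to a weak symplectic form *)

Section SymplecticComplement.
Context {R : realType} {H : hilbertType R} (omega : H -> H -> Cplx R).
Context (omegaP : weak_symplectic omega).

Let omegaDl x y z : omega (x + y) z = omega x z + omega y z.
Proof. by rewrite -[x]scale1r (symplecticPl omegaP) mul1r scale1r. Qed.

Let omegaDr x y z : omega z (x + y) = omega z x + omega z y.
Proof. by rewrite -[x]scale1r (symplecticPr omegaP) conjC1 mul1r scale1r. Qed.

Let omega0l z : omega 0 z = 0.
Proof. by apply: (addrI (omega 0 z)); rewrite -omegaDl !addr0. Qed.

Let omega0r z : omega z 0 = 0.
Proof. by apply: (addrI (omega z 0)); rewrite -omegaDr !addr0. Qed.

Let omegaZl a x z : omega (a *: x) z = a * omega x z.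
Proof. by rewrite -[a *: x]addr0 (symplecticPl omegaP) omega0l addr0. Qed.

Let omegaZr a x z : omega z (a *: x) = a^* * omega z x.
Proof. by rewrite -[a *: x]addr0 (symplecticPr omegaP) omega0r addr0. Qed.

Let omegaBl x y z : omega (x - y) z = omega x z - omega y z.
Proof. by rewrite omegaDl -scaleN1r omegaZl mulN1r. Qed.

Let omegaBr x y z : omega z (x - y) = omega z x - omega z y.
Proof. by rewrite omegaDr -scaleN1r omegaZr rmorphN1 mulN1r. Qed.

Lemma symplectic_suml n (c : 'I_n -> Cplx R) (e : 'I_n -> H) z :
  omega (\sum_i c i *: e i) z = \sum_i c i * omega (e i) z.
Proof.
rewrite (big_morph (omega^~ z) (fun x y => omegaDl x y z) (omega0l z)).
by apply: eq_bigr => i _; exact: omegaZl.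
Qed.

Let omega_sumr n (c : 'I_n -> Cplx R) (e : 'I_n -> H) z :
  omega z (\sum_i c i *: e i) = \sum_i (c i)^* * omega z (e i).
Proof.
rewrite (big_morph (omega z) (fun x y => omegaDr x y z) (omega0r z)).
by apply: eq_bigr => i _; exact: omegaZr.
Qed.

Lemma symplectic_eq0C x y : omega x y = 0 -> omega y x = 0.
Proof. by move=> xy; rewrite (symplectic_skew omegaP) xy conjC0 oppr0. Qed.

Lemma symplectic_eq0l x : (forall y, omega x y = 0) -> x = 0.
Proof.
by move=> x0; have : [set x | forall y, omega x y = 0] x by [];
  rewrite (symplectic_nondegenerate omegaP).
Qed.

Lemma annihilator_closed (S : set H) :
  closed [set y | forall x, S x -> omega x y = 0].
Proof.
move=> y cly x Sx; apply/eqP; apply: contraT => xy0.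
have [k kP] := symplectic_bounded omegaP.
have xy_gt0 : 0 < `|omega x y| by rewrite normr_gt0.
have y_gt0 : 0 < `|y|.
  by rewrite normr_gt0; apply: contra_neq xy0 => ->; exact: omega0r.
(* The sign of [k] is not given; the bound at [(x, y)] forces this product to be positive. *)
have k_gt0 : 0 < k * `|x|.
  by have := lt_le_trans xy_gt0 (kP x y); rewrite pmulr_lgt0.
have e_gt0 : 0 < `|omega x y| / (k * `|x|) by rewrite divr_gt0.
have [z [Sz]] := cly _ (nbhsx_ballx y _ e_gt0).
rewrite -ball_normE /ball_ /= ltr_pdivlMr// mulrC => yz.
have := le_lt_trans (kP x (y - z)) yz.
by rewrite omegaBr (Sz _ Sx) subr0 ltxx.
Qed.

(** Conjugating the coefficients of a relation between the functionals [omega v (b i)] of [v] gives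
    a combination of the [b i] that pairs to zero with everything; it vanishes by nondegeneracy, so
    the functionals are free. *)
Lemma symplectic_dual_family n (b : 'I_n -> H) :
    (forall c : 'I_n -> Cplx R, \sum_i c i *: b i = 0 -> forall i, c i = 0) ->
  exists e : 'I_n -> H, forall i k, omega (e k) (b i) = (i == k)%:R.
Proof.
move=> bfree; apply: (@dual_family _ _ _ (fun i v => omega v (b i))).
  by move=> *; exact: (symplecticPl omegaP).
move=> c c0 i; rewrite -[c i]conjCK.
rewrite (bfree (fun i => (c i)^*)) ?conjC0//.
apply: symplectic_eq0l => v; apply: symplectic_eq0C; rewrite omega_sumr -[RHS](c0 v).
by apply: eq_bigr => k _; rewrite conjCK.
Qed.

(** The numbers [omega x (b i)] are coordinates on the quotient, and the classes of the dual family
    are the corresponding basis. *)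
Lemma annihilator_codim (U : set H) n (S : lsub H) : has_dim U n ->
    S = [set x | forall u, U u -> omega x u = 0] :> set H ->
  has_dim [set: lquot S] n.
Proof.
move=> [b [bfree ->]] SE; have [e eP] := symplectic_dual_family bfree.
have sume (c : 'I_n -> Cplx R) i : omega (\sum_k c k *: e k) (b i) = c i.
  by rewrite symplectic_suml; under eq_bigr do rewrite eP; exact: sum_mulr_eq.
have projE (c : 'I_n -> Cplx R) :
    \sum_k c k *: lproj S (e k) = lproj S (\sum_k c k *: e k).
  by rewrite linear_sum; apply: eq_bigr => k _; rewrite linearZ.
exists (fun k => lproj S (e k)); split=> [c|].
  rewrite projE -(linear0 (lproj S)) => /lproj_eq; rewrite subr0 SE => cP i.
  by rewrite -[LHS]sume; apply/cP/mem_span.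
apply/seteqP; split=> // q _; exists (fun k => omega (lrepr q) (b k)) => //.
rewrite projE -[RHS]lreprK; apply/lproj_eq; rewrite SE => _ [d _ <-].
rewrite omega_sumr big1// => i _.
by rewrite omegaBl sume subrr mulr0.
Qed.

(** Subtracting from [x] a combination of dual vectors leaves an element that annihilates [U], hence
    [y]. This computes [omega x y] as the pairing of [x] with an explicit combination of the [b i],
    and nondegeneracy identifies that combination with [y]. *)
Lemma finite_dim_annihilator_annihilator (U : set H) y : finite_dim U ->
  (forall x, (forall u, U u -> omega x u = 0) -> omega x y = 0) -> U y.
Proof.
move=> [n [b [bfree ->]]] yP; have [e eP] := symplectic_dual_family bfree.
exists (fun i => (omega (e i) y)^*) => //; apply/esym/subr0_eq/symplectic_eq0l => x.
apply: symplectic_eq0C.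
have := yP (x - \sum_i omega x (b i) *: e i).
rewrite omegaBl omegaBr symplectic_suml omega_sumr => /(_ _)/eqP.
rewrite subr_eq0 => xy; apply/eqP; rewrite subr_eq0.
rewrite (eqP (xy _)); first by apply/eqP; apply: eq_bigr => i _; rewrite conjCK mulrC.
move=> _ [d _ <-]; rewrite omega_sumr big1// => i _.
rewrite omegaBl symplectic_suml; under [X in _ - X]eq_bigr do rewrite eP.
by rewrite (sum_mulr_eq (fun i => omega x (b i))) subrr mulr0.
Qed.

Lemma lagrangian_closed (l : lsub H) : lagrangian omega l -> closed l.
Proof. by move=> ->; exact: annihilator_closed. Qed.

(* Isotropy gives l + m ⊆ (l ∩ m)^ω, and (l ∩ m)^ωω = l ∩ m *)
Lemma lagrangian_fredholm_pair (l m : lsub H) : lagrangian omega l ->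
    (forall x y, m x -> m y -> omega x y = 0) -> finite_dim (capS l m) ->
    (forall x, (forall u, capS l m u -> omega x u = 0) -> addS l m x) ->
  [/\ lagrangian omega m, fredholm_pair l m & fredholm_index l m = 0].
Proof.
move=> lL m0 lm_fin lmP.
have l0 x y : l x -> l y -> omega x y = 0 by rewrite {2}lL => lx; exact.
have lmE : addS l m = [set x | forall u, capS l m u -> omega x u = 0] :> set H.
  apply/seteqP; split=> [_ [x lx [y my <-]] u [lu mu]|x /lmP//].
  by rewrite omegaDl l0// m0// addr0.
have mL : lagrangian omega m.
  apply/seteqP; split=> [y my x mx|y yP]; first exact: m0.
  have : addS l m y.
    by apply: lmP => u [_ mu]; apply: symplectic_eq0C; exact: yP.
  (* With [y = x + z], the part [x] annihilates [l] by isotropy, and [m] because [y] and [z] do. So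
     it annihilates [addS l m], and the double annihilator puts it in [capS l m]. *)
  move=> [x lx [z mz xzy]]; rewrite -xzy.
  suff [_ mx] : capS l m x by exact: lsubD.
  apply: finite_dim_annihilator_annihilator => // v /lmP[v1 lv1 [v2 mv2 <-]].
  rewrite omegaDl l0// add0r -[x](addrK z) xzy omegaBr yP// m0// subrr//.
have [n lm_n] := lm_fin.
have q_n := annihilator_codim lm_n lmE.
split=> //; last by rewrite /fredholm_index (dim_eq lm_n) (dim_eq q_n) subrr.
split=> //; [exact: lagrangian_closed | exact: lagrangian_closed | | by exists n].
rewrite lmE [X in closed X](_ : _ = [set y | forall x, capS l m x -> omega x y = 0]).
  exact: annihilator_closed.
by apply/seteqP; split=> x xP u /xP; exact: symplectic_eq0C.
Qed.

End SymplecticComplement.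

(** * Closed symmetric operators, their adjoints and Green's form *)

Section Operators.
Context {R : realType} {X : hilbertType R}.
Implicit Types T : linrel X.

Lemma Cauchy_Schwarz (x y : X) : `|inner x y| <= `|x| * `|y|.
Proof.
have [->|y0] := eqVneq y 0; first by rewrite inner0r !normr0 mulr0.
have ny : 0 < `|y| ^+ 2 by rewrite exprn_gt0// normr_gt0.
rewrite -(@ler_pXn2r _ 2)// ?nnegrE ?mulr_ge0// exprMn -ler_pdivrMr//.
have := exprn_ge0 2 (normr_ge0 (x - (inner x y / `|y| ^+ 2) *: y)).
rewrite -inner_norm; set c := inner x y / _.
rewrite innerBl !innerBr !innerZl !innerZr.
have -> : c * (c^* * inner y y) = c^* * inner x y.
  by rewrite mulrCA inner_norm /c divfK// gt_eqF.
have -> : c^* * inner x y = `|inner x y| ^+ 2 / `|y| ^+ 2.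
  have nr : (`|y| ^+ 2)^* = `|y| ^+ 2 by apply/CrealP; exact: rpredX (normr_real _).
  rewrite /c rmorphM fmorphV [in X in X * _ = _]/= nr.
  by rewrite normCK mulrAC [_^* * _]mulrC.
have -> : c * inner y x = `|inner x y| ^+ 2 / `|y| ^+ 2.
  by rewrite /c [inner y x]innerC mulrAC normCK.
by rewrite subrr subr0 inner_norm subr_ge0.
Qed.

Definition ran_add_i T : lsub X.
Proof.
exists [set p.2 + 'i *: p.1 | p in T].
  by exists 0; [exact: lsub0 | rewrite scaler0 addr0].
move=> a _ _ [p Tp <-] [q Tq <-]; exists (a *: p + q); first exact: lsubP.
by rewrite /= !scalerDr !scalerA mulrC addrACA.
Defined.

(** Symmetry cancels the two cross terms, so the square of the right-hand side is the sum of the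
    squared norms of [p.1] and [p.2]. *)
Lemma symmetric_norm_le_add_i T p : op_symmetric T -> T p ->
  `|p.1| <= `|p.2 + 'i *: p.1|.
Proof.
move=> Tsym Tp; rewrite -(@ler_pXn2r _ 2)// ?nnegrE// normDE innerZl innerZr.
rewrite (Tsym _ Tp _ Tp) conjCi mulNr addNr addr0 normrZ normCi mul1r.
by rewrite lerDr exprn_ge0.
Qed.

(** By the previous bound, the preimages under [T + i] of a convergent filter have Cauchy first
    components; closedness of the graph then provides a preimage of the limit. *)
Lemma ran_add_i_closed T : closed (T : set (X * X)) -> op_symmetric T ->
  closed (ran_add_i T).
Proof.
move=> Tcl Tsym y; rewrite closureEcvg => -[G GG [Gy ranG]].
(* The default 0 occurs only outside the range, and the range belongs to [G]. *)
pose g z : X * X := xget 0 [set p | T p /\ p.2 + 'i *: p.1 = z].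
have gP z : ran_add_i T z -> T (g z) /\ (g z).2 + 'i *: (g z).1 = z.
  by move=> [p Tp pz]; apply: (@xgetI _ 0 [set p | T p /\ p.2 + 'i *: p.1 = z] p).
have Gran : G (ran_add_i T) by exact: ranG.
have : cauchy ((fun z => (g z).1) @ G).
  apply: cauchy_exP => e e0; have e20 : 0 < e / 2 by rewrite divr_gt0.
  have Ge : G [set z | `|y - z| < e / 2].
    by move/cvgrPdist_lt : Gy => /(_ _ e20).
  have [z0 [z0e /gP[Tz0 z0E]]] := filter_ex (filterI Ge Gran).
  exists (g z0).1; rewrite /fmap /=; near=> z.
  have [Tz zE] : T (g z) /\ (g z).2 + 'i *: (g z).1 = z.
    by apply: gP; near: z.
  have ze : `|y - z| < e / 2 by near: z.
  rewrite -ball_normE /ball_ /=.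
  have := symmetric_norm_le_add_i Tsym (lsubB Tz0 Tz).
  rewrite /= scalerBr addrACA -opprD z0E zE => /le_lt_trans; apply.
  rewrite -(subrK y z0) -addrA; apply: le_lt_trans (ler_normD _ _) _.
  by rewrite (splitr e) ltrD// distrC.
move=> /(cauchy_cvg _) /cvg_ex[u gu].
exists (u, y - 'i *: u); last by rewrite /= subrK.
have Gg : (fun z => ((g z).1, z - 'i *: (g z).1)) @ G --> (u, y - 'i *: u).
  apply: cvg_pair => //; apply: cvgB => //; by apply: cvgZ => //; exact: cvg_cst.
refine (@closed_cvg _ _ G GG _ (T : set (X * X)) Tcl _ _ Gg).
apply: filterS Gran => z /gP[]; case: (g z) => p1 p2 /= Tp <-.
by rewrite addrK.
Unshelve. all: by end_near.
Qed.

Lemma adjointC T p q : T p -> adjoint T q -> inner p.1 q.2 = inner p.2 q.1.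
Proof. by move=> Tp /(_ _ Tp). Qed.

(* Decompose y + ix along ran (A + i): its component r orthogonal to that range
   satisfies A^* r = ir, hence is orthogonal to y + ix.  This leaves an element v
   of the domain with A^* v = -iv, so v = 0 by symmetry. *)
Lemma adjoint_adjoint_closed (A : csd_operator X) p :
  adjoint A p -> adjoint (adjoint A) p -> A p.
Proof.
move: p => [x y] Axy AAxy.
have Rcl := ran_add_i_closed (@csd_closed _ _ A) (@csd_symmetric _ _ A).
have [_ [p Ap <-] orth] := projection_exists (ClosedLsub Rcl) (y + 'i *: x).
set r := y + _ - _ in orth.
have Ar : adjoint A (r, 'i *: r).
  move=> q Aq /=; have /eqP : inner r (q.2 + 'i *: q.1) = 0 by apply: orth; exists q.
  rewrite innerDr innerZr conjCi mulNr subr_eq0 => /eqP rq.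
  by rewrite innerC rq rmorphM /= conjCi -innerC innerZr conjCi.
(* Hence [v], the difference of [(x, y)] and [p], lies in both [adjoint A] and its adjoint; it is
   paired first with [(r, 'i *: r)], then with itself. *)
have AAp : adjoint (adjoint A) p.
  by move=> q Aq; rewrite innerC (adjointC Ap Aq) -innerC.
have AAv := lsubB AAxy AAp; have Av := lsubB Axy (csd_symmetric Ap).
have rE : r = (y - p.2) + 'i *: (x - p.1).
  by rewrite /r scalerBr opprD addrACA.
have r0 : r = 0.
  apply: inner_eq0; rewrite [in X in inner _ X]rE innerDr innerZr conjCi.
  by have := AAv _ Ar; rewrite /= innerZl => <-; rewrite mulNr addrN.
have vE : y - p.2 = - ('i *: (x - p.1)) by apply/eqP; rewrite -addr_eq0 -rE r0.
have v0 : x - p.1 = 0.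
  apply: inner_eq0; have := AAv _ Av; rewrite /= vE innerNl innerNr innerZl innerZr.
  set s := inner _ _; rewrite conjCi mulNr opprK => is0.
  have : 'i * s *+ 2 == 0 by rewrite mulr2n -{1}is0 addNr.
  by rewrite mulrn_eq0 mulf_eq0 (negPf (neq0Ci _)) => /eqP.
have y0 : y - p.2 = 0 by rewrite vE v0 scaler0 oppr0.
by move: Ap; rewrite (surjective_pairing p) -(subr0_eq v0) -(subr0_eq y0).
Qed.

(** The residual of [y] after projection on the range is orthogonal to the range, hence lies in the
    kernel of the adjoint, which is that of [T]. As [y] is orthogonal to this kernel, the residual
    is zero. *)
Lemma self_adjoint_ran T y : self_adjoint T -> closed (op_ran T) ->
  (forall n, op_ker T n -> inner y n = 0) -> op_ran T y.
Proof.
move=> Tsa Tcl yker.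
have [z Tz orth] := projection_exists (ClosedLsub Tcl) y.
suff /subr0_eq -> : y - z = 0 by [].
apply: inner_eq0; rewrite innerBr (orth _ Tz) subr0 innerC yker ?conjC0//.
rewrite /op_ker/= Tsa => -[q1 q2] Tq /=.
by rewrite inner0r innerC orth ?conjC0//; exists q1.
Qed.

Lemma green_formE T (x x' y y' : X) : dense (op_dom T) ->
    adjoint T (x, x') -> adjoint T (y, y') ->
  green_form T x y = inner x' y - inner x y'.
Proof.
move=> Td xx' yy'; have sv := adjoint_single_valued Td.
by rewrite /green_form (opval_eq sv xx') (opval_eq sv yy').
Qed.

Lemma green_formC T (x y : X) : green_form T y x = - (green_form T x y)^*.
Proof. by rewrite /green_form rmorphB /= -!innerC opprB. Qed.

Lemma green_formPl T a (x y z : X) : dense (op_dom T) ->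
    op_dom (adjoint T) x -> op_dom (adjoint T) y -> op_dom (adjoint T) z ->
  green_form T (a *: x + y) z = a * green_form T x z + green_form T y z.
Proof.
move=> Td [x' xx'] [y' yy'] [z' zz'].
rewrite (green_formE Td xx' zz') (green_formE Td yy' zz').
rewrite (green_formE Td (lsubP a xx' yy') zz') /= !innerP mulrBr opprD.
by rewrite addrACA.
Qed.

Lemma green_form_eq0 T (x y : X) : dense (op_dom T) -> op_symmetric T ->
  op_dom T x -> op_dom (adjoint T) y -> green_form T x y = 0.
Proof.
move=> Td Ts [x' xx'] [y' yy'].
by rewrite (green_formE Td (Ts _ xx') yy') (adjointC xx' yy') subrr.
Qed.

Lemma green_form_le T (x y : X) :
  `|green_form T x y| <= 2 * graph_norm (adjoint T) x * graph_norm (adjoint T) y.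
Proof.
have le a b : a <= graph_norm (adjoint T) x -> b <= graph_norm (adjoint T) y ->
    0 <= a -> 0 <= b -> a * b <= graph_norm (adjoint T) x * graph_norm (adjoint T) y.
  by move=> *; exact: ler_pM.
rewrite /green_form; apply: le_trans (ler_normB _ _) _.
rewrite -mulrA mulr_natl mulr2n; apply: lerD; apply: le_trans (Cauchy_Schwarz _ _) _.
  by apply: le => //; [exact: opval_le_graph_norm | exact: norm_le_graph_norm].
by apply: le => //; [exact: norm_le_graph_norm | exact: opval_le_graph_norm].
Qed.

End Operators.

(** * Green's form on the quotient by the minimal domain *)

Section ReducedForm.
Context {R : realType} {X W : hilbertType R} {A : csd_operator X}.
Context {j : {linear W -> X}} (hW : intermediate_space A j).

Let Ad : dense (op_dom A) := @csd_dense _ _ A.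

Lemma dom_max_incl w : op_dom (adjoint A) (j w).
Proof. by apply: (sub_dom_max hW); exists w. Qed.

(** Two representatives differ by an element of the domain of [A], which Green's form pairs to zero
    with the maximal domain; skew symmetry handles the second argument. *)
Lemma reduced_formE v w :
  reduced_form hW (hproj (dom_min hW) v) (hproj (dom_min hW) w) =
  green_form A (j v) (j w).
Proof.
have green_repr u x : op_dom (adjoint A) x ->
    green_form A (j (lrepr (hproj (dom_min hW) u))) x = green_form A (j u) x.
  move=> Ax; have du : op_dom A (j (lrepr (hproj (dom_min hW) u) - u)).
    exact: (@lreprP _ _ (dom_min hW) u).
  rewrite -[in LHS](subrK u (lrepr _)) -[_ - u]scale1r linearP.
  rewrite green_formPl ?(green_form_eq0 Ad (@csd_symmetric _ _ A) du Ax)//.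
  - by rewrite mulr0 add0r.
  - exact: dom_max_incl.
  - exact: dom_max_incl.
rewrite /reduced_form green_repr; last exact: dom_max_incl.
rewrite green_formC green_repr; last exact: dom_max_incl.
by rewrite -green_formC.
Qed.

Context (W_dense : forall x, op_dom (adjoint A) x -> forall e : Cplx R, 0 < e ->
  exists w, graph_norm (adjoint A) (x - j w) < e).

(** By density the pairing vanishes on the whole maximal domain, so [j w] and its value belong to
    the double adjoint, and thus to [A]. *)
Lemma green_form_nondegenerate w :
  (forall v, green_form A (j w) (j v) = 0) -> op_dom A (j w).
Proof.
move=> w0; have [w' ww'] := dom_max_incl w.
suff wP z : op_dom (adjoint A) z -> green_form A (j w) z = 0.
  exists w'; apply: adjoint_adjoint_closed => // -[z z'] zz' /=.
  have /eqP : green_form A (j w) z = 0 by apply: wP; exists z'.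
  rewrite (green_formE Ad ww' zz') subr_eq0 => /eqP wz.
  by rewrite innerC -wz -innerC.
move=> zdom; apply/eqP; apply: contraT => wz.
pose c := 2 * graph_norm (adjoint A) (j w).
have c_ge0 : 0 <= c.
  by rewrite mulr_ge0// (le_trans (normr_ge0 _) (norm_le_graph_norm _ _)).
have wz_gt0 : 0 < `|green_form A (j w) z| by rewrite normr_gt0.
(* [c] may be 0, hence the division by [c + 1]. For [j v] this close to [z], the pairing with
   [z - j v], equal to that with [z], would be smaller than itself. *)
have e_gt0 : 0 < `|green_form A (j w) z| / (c + 1) by rewrite divr_gt0// ltr_wpDl.
have [v] := W_dense zdom e_gt0; rewrite ltr_pdivlMr ?ltr_wpDl// => zv.
have zE : green_form A (j w) (z - j v) = green_form A (j w) z.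
  have -> : z - j v = (-1) *: j v + z by rewrite scaleN1r addrC.
  rewrite green_formC green_formPl//; do ?exact: dom_max_incl.
  by rewrite [in X in _ * X]green_formC w0 conjC0 oppr0 mulr0 add0r -green_formC.
have := green_form_le A (j w) (z - j v); rewrite zE -/c => /le_lt_trans.
move=> /(_ _ (le_lt_trans _ zv)); rewrite ltxx; apply.
rewrite mulrC ler_wpM2l//; last by rewrite lerDl.
by rewrite (le_trans (normr_ge0 _) (norm_le_graph_norm _ _)).
Qed.

Lemma reduced_form_symplectic : weak_symplectic (reduced_form hW).
Proof.
split=> [a x y z|a x y z||x y|].
- rewrite -(hreprK x) -(hreprK y) -(hreprK z) -linearP !reduced_formE linearP.
  by rewrite green_formPl//; exact: dom_max_incl.
- rewrite -(hreprK x) -(hreprK y) -(hreprK z) -linearP !reduced_formE linearP.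
  rewrite green_formC green_formPl//; do ?exact: dom_max_incl.
  by rewrite rmorphD rmorphM opprD -mulrN -!green_formC.
- have [k kP] := incl_max_continuous hW.
  (* Representatives of minimal norm realise the quotient norm, so the bound [k] of the inclusion
     enters once per argument. *)
  exists (2 * k * k) => x y; rewrite -{1}(hreprK x) -{1}(hreprK y) reduced_formE.
  apply: le_trans (green_form_le _ _ _) _.
  rewrite !hquot_normE -!mulrA ler_pM2l ?ltr0n// mulrCA [leRHS]mulrA -mulrA.
  rewrite (mulrCA k) mulrA.
  have ge0 z : 0 <= graph_norm (adjoint A) z.
    exact: le_trans (normr_ge0 z) (norm_le_graph_norm _ _).
  by apply: ler_pM.
- by rewrite -(hreprK x) -(hreprK y) !reduced_formE green_formC.
apply/seteqP; split=> [p pP|p -> y] /=.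
  rewrite -(hreprK p) -(linear0 (hproj (dom_min hW))); apply/hproj_eq.
  rewrite subr0; apply: green_form_nondegenerate => v.
  by rewrite -reduced_formE hreprK.
rewrite -(hreprK y) -(linear0 (hproj (dom_min hW))) reduced_formE linear0.
apply: green_form_eq0 => //; [exact: csd_symmetric | exact: (lsub0 (op_dom A)) |].
exact: dom_max_incl.
Qed.

End ReducedForm.

(** * The reduced Cauchy data space and the range of [adjoint A] *)

Theorem proposition2p3 (R : realType) (X : hilbertType R) (A : csd_operator X)
    (W : hilbertType R) (j : {linear W -> X})
    (* (a) *)
    (hW : intermediate_space A j)
    (* (b) *)
    (norm_equiv : exists k1 k2 : Cplx R, [/\ 0 < k1, 0 < k2 &
      forall w, op_dom A (j w) ->
        k1 * graph_norm A (j w) <= `|w| /\ `|w| <= k2 * graph_norm A (j w)])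
    (* (c) *)
    (W_dense : forall x, op_dom (adjoint A) x -> forall e : Cplx R, 0 < e ->
      exists w, graph_norm (adjoint A) (x - j w) < e)
    (* (d) *)
    (D : lsub X) (AD : linrel X)
    (AD_def : AD = op_restrict (adjoint A) D)
    (Dm_sub_D : op_dom A `<=` D) (D_sub_W : D `<=` range j)
    (AD_extends : A `<=` AD) (AD_self_adjoint : self_adjoint AD)
    (AD_fredholm : fredholm AD) :
  let AW : linrel X := op_restrict (adjoint A) (imageS j lsubT) in
  let omega := reduced_form hW in
  let lambda := reduced hW D in
  let mu := reduced hW (addS (op_ker AW) (op_dom A)) in
  [/\ (forall v w, omega (hproj (dom_min hW) v) (hproj (dom_min hW) w) =
         green_form A (j v) (j w))
      /\ weak_symplectic omega,
      lagrangian omega lambda,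
      lagrangian omega mu,
      fredholm_pair lambda mu /\ fredholm_index lambda mu = 0
    & op_ran AW = op_ran (adjoint A) :> set X].
Proof.
move=> AW omega lambda mu.
have Ad : dense (op_dom A) := @csd_dense _ _ A.
have omegaP : weak_symplectic omega by exact: reduced_form_symplectic.
have omegaE v w : omega (hproj _ v) (hproj _ w) = green_form A (j v) (j w).
  exact: reduced_formE.
have AstarP w : adjoint A (j w, opval (adjoint A) (j w)).
  by apply: opvalP; exact: dom_max_incl.
have ADE p : AD p <-> adjoint A p /\ D p.1 by rewrite AD_def.
have ker_ADE x : op_ker AD x <-> adjoint A (x, 0) /\ D x by exact: ADE.
have lambdaE w : lambda (hproj _ w) <-> D (j w).
  split=> [[v Dv /hproj_eq vw]|]; last by exists w.
  rewrite -(subKr (j v) (j w)) -linearB; apply: (@lsubB _ _ D) => //.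
  exact: Dm_sub_D.
(* The component in the domain of [A] is absorbed by the quotient, so a class in [mu] has a
   representative in the kernel. *)
have muE p : mu p <-> exists2 w, adjoint A (j w, 0) & p = hproj _ w.
  split=> [[v [k [Ak [u _ /= uk]] [m Am kmv]] <-]|[w Aw ->]].
    exists u; first by rewrite uk.
    by apply/hproj_eq; rewrite /= linearB -kmv uk addrAC subrr add0r.
  exists w => //; exists (j w); first by split=> //; exists w.
  by exists 0; [exact: lsub0 | rewrite addr0].
have capE w : op_ker AD (j w) -> capS lambda mu (hproj _ w).
  by move=> /ker_ADE[Aw Dw]; split; [exact/lambdaE | apply/muE; exists w].
have capP p : capS lambda mu p -> exists2 w, op_ker AD (j w) & p = hproj _ w.
  move=> [lp /muE[w Aw pw]]; exists w => //.
  by apply/ker_ADE; split=> //; apply/lambdaE; rewrite -pw.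
have ker_AD_incl x : op_ker AD x -> exists w, j w = x.
  by move=> /ker_ADE[_ /D_sub_W[w _ <-]]; exists w.
have ran_ADP y : (forall w, op_ker AD (j w) -> inner y (j w) = 0) -> op_ran AD y.
  move=> yker; have [_ _ ran_closed _] := AD_fredholm.
  apply: self_adjoint_ran => // n nker.
  by have [w wn] := ker_AD_incl _ nker; rewrite -wn; apply: yker; rewrite wn.
(* The two inclusions in the self-adjointness of [AD] give isotropy and maximality respectively. *)
have lambdaL : lagrangian omega lambda.
  apply/seteqP; split=> [_ [w Dw <-] _ [v Dv <-]|p pP].
    have ADv : AD (j v, opval (adjoint A) (j v)) by apply/ADE.
    have := ADE (j w, opval (adjoint A) (j w)) => -[_ /(_ (conj (AstarP w) Dw))].
    rewrite AD_self_adjoint => /(_ _ ADv) /= vw.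
    by rewrite omegaE (green_formE Ad (AstarP v) (AstarP w)) vw subrr.
  rewrite -(hreprK p) in pP *; set w := hrepr p in pP *; apply/lambdaE.
  suff /ADE[] : AD (j w, opval (adjoint A) (j w)) by [].
  rewrite AD_self_adjoint => -[q1 q2] /ADE[Aq Dq] /=.
  have [v _ /= vq] := D_sub_W _ Dq; rewrite -vq in Aq Dq *.
  have /pP : lambda (hproj _ v) by exact/lambdaE.
  by rewrite omegaE (green_formE Ad Aq (AstarP w)) => /eqP; rewrite subr_eq0 => /eqP.
have mu0 p q : mu p -> mu q -> omega p q = 0.
  move=> /muE[v Av ->] /muE[w Aw ->].
  by rewrite omegaE (green_formE Ad Av Aw) inner0l inner0r subrr.
(* The image of a basis of the kernel of [AD] spans the intersection but need not be free: the
   kernel of [A] dies in the quotient. *)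
have cap_fin : finite_dim (capS lambda mu).
  have [_ [n [b [_ kerE]]] _ _] := AD_fredholm.
  have /choice[w wb] : forall i, exists w, j w = b i.
    by move=> i; apply: ker_AD_incl; rewrite kerE; exact: mem_span.
  rewrite [X in finite_dim X](_ : _ = range (fun c : 'I_n -> Cplx R =>
      \sum_i c i *: hproj (dom_min hW) (w i))); first exact: span_finite_dim.
  have sumE (c : 'I_n -> Cplx R) : \sum_i c i *: hproj (dom_min hW) (w i) =
      hproj (dom_min hW) (\sum_i c i *: w i).
    by rewrite linear_sum; apply: eq_bigr => i _; rewrite linearZ.
  have jsumE (c : 'I_n -> Cplx R) : j (\sum_i c i *: w i) = \sum_i c i *: b i.
    by rewrite linear_sum; apply: eq_bigr => i _; rewrite linearZ/= wb.
  apply/seteqP; split=> [p /capP[v]|_ [c _ <-]].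
    rewrite kerE => -[c _ cv] ->; exists c => //; rewrite sumE; congr (hproj _ _).
    by apply: (incl_inj hW); rewrite jsumE.
  by rewrite sumE; apply: capE; rewrite kerE jsumE; exists c.
have cap_sum p : (forall u, capS lambda mu u -> omega p u = 0) -> addS lambda mu p.
  rewrite -(hreprK p); set w := hrepr p => wP.
  have [|d] := ran_ADP (opval (adjoint A) (j w)).
    move=> v /[dup] /ker_ADE[Av _] /capE /wP.
    by rewrite omegaE (green_formE Ad (AstarP w) Av) inner0r subr0.
  (* Subtracting the preimage [d] in [D] from [w] leaves an element of the kernel of [AW], whose
     class is in [mu]. *)
  move=> /ADE[Ad' /[dup] Dd /D_sub_W[v _ /= vd]]; rewrite -vd in Ad' Dd.
  exists (hproj _ v); first exact/lambdaE.
  exists (hproj _ (w - v)); last by rewrite linearB addrC subrK.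
  apply/muE; exists (w - v) => //.
  rewrite linearB -(subrr (opval (adjoint A) (j w))).
  exact: lsubB (AstarP w) Ad'.
have [muL pairP index0] := lagrangian_fredholm_pair omegaP lambdaL mu0 cap_fin cap_sum.
split=> //.
apply/seteqP; split=> [y [x [Axy _]]|y [x Axy]]; first by exists x.
have [n [u [ufree capuE]]] := cap_fin.
have [e eP] := symplectic_dual_family omegaP ufree.
have /choice[v vP] : forall i, exists v, op_ker AD (j v) /\ u i = hproj _ v.
  move=> i; have : capS lambda mu (u i) by rewrite capuE; exact: mem_span.
  by move=> /capP[v]; exists v.
(* The coefficients make the pairing of the class of [w] with [u i] equal to [inner y (j (v i))]. *)
pose w := hrepr (\sum_i inner y (j (v i)) *: e i).
have wv i : inner (opval (adjoint A) (j w)) (j (v i)) = inner y (j (v i)).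
  have [/ker_ADE[Av _] uv] := vP i.
  have := omegaE w (v i).
  rewrite (green_formE Ad (AstarP w) Av) inner0r subr0 => <-.
  rewrite /w hreprK -uv symplectic_suml//; under eq_bigr do rewrite eP.
  exact: (sum_mulr_eq (fun i => inner y (j (v i)))).
have [|d] := ran_ADP (y - opval (adjoint A) (j w)).
  move=> z zker; have : capS lambda mu (hproj _ z) by exact: capE.
  rewrite capuE => -[c _ cz].
  (* The [v i] span the kernel of [AD] only modulo the domain of [A]. The part [z'] is handled by
     [wv]; on [z - z'] the scalar product is a Green form with one argument in the domain of [A],
     hence zero. *)
  pose z' := \sum_i c i *: v i.
  have zz' : op_dom A (j (z - z')).
    apply/(hproj_eq (dom_min hW)); rewrite -cz linear_sum.
    by apply: eq_bigr => i _; rewrite linearZ (vP i).2.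
  have z'ker : op_ker AD (j z').
    rewrite linear_sum; apply: (big_ind (op_ker AD)); first exact: lsub0.
      exact: lsubD.
    by move=> i _; rewrite linearZ; apply: lsubZ; exact: (vP i).1.
  have z'0 : inner (y - opval (adjoint A) (j w)) (j z') = 0.
    rewrite linear_sum; apply: (big_ind (fun x => inner _ x = 0)).
    - exact: inner0r.
    - by move=> a b a0 b0; rewrite innerDr a0 b0 addr0.
    - by move=> i _; rewrite linearZ innerZr innerBl wv subrr mulr0.
  have := lsubB zker z'ker; rewrite -linearB => /ker_ADE[Azz' _].
  rewrite -(subrK z' z) linearD innerDr z'0 addr0.
  have /= := green_formE Ad (lsubB Axy (AstarP w)) Azz'.
  rewrite inner0r subr0 => <-; rewrite green_formC.
  rewrite green_form_eq0 ?conjC0 ?oppr0//; first exact: csd_symmetric.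
  by eexists; exact: (lsubB Axy (AstarP w)).
move=> /ADE[Ady /D_sub_W[v' _ /= v'd]]; rewrite -v'd in Ady.
exists (j (v' + w)); split; last by exists (v' + w).
rewrite -(subrK (opval (adjoint A) (j w)) y) linearD.
exact: (lsubD Ady (AstarP w)).
Qed.
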